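(* Let $1/2<\alpha<1$, $\omega^\alpha_+(x)=\frac{1}{|x|\,|\log|x||^\alpha}\chi_{B^+(0;1/3)}(x)$ on $\mathbb{R}^2$, and $u^\alpha_+=K\ast\omega^\alpha_+$. Then $u^\alpha_+$ is unbounded. If moreover $1/2<\alpha\le2/3$, then $u^\alpha_+|\omega^\alpha_+|^2$ is not locally integrable.
   Context: $B^+(0;1/3)=\{x\in\mathbb{R}^2:|x|<1/3,\ x_2>0\}$; $\chi_E$ is the characteristic function of $E$. $K(x)=\frac{x^\perp}{2\pi|x|^2}$, $(x_1,x_2)^\perp=(-x_2,x_1)$, is the Biot–Savart kernel. The paper defines $\omega^\alpha_+$ under the standing assumption $1/2<\alpha<1$. *)

(* Defs.v *)
From HB Require Import structures.
From mathcomp Require Import all_boot all_order all_algebra.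
From mathcomp Require Import all_classical all_reals all_analysis.
Set Implicit Arguments. Unset Strict Implicit. Unset Printing Implicit Defensive.
Import Order.TTheory GRing.Theory Num.Theory.
Import numFieldNormedType.Exports.
Local Open Scope classical_set_scope.
Local Open Scope ring_scope.

Section defs.
Variable R : realType.

Definition leb2 := ((@lebesgue_measure R) \x (@lebesgue_measure R))%E.

Definition norm2 (x : R * R) : R := Num.sqrt (x.1 ^+ 2 + x.2 ^+ 2).

Definition Bplus : set (R * R) := [set x | norm2 x < 3^-1 /\ 0 < x.2].

Definition omega_plus (a : R) (x : R * R) : R :=
  if x \in Bplus then
    (norm2 x * (`|ln (norm2 x)| `^ a))^-1
  else 0.

(* Biot-Savart kernel K(x) = x^perp / (2 pi |x|^2), x^perp = (-x2, x1) *)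
Definition BS (x : R * R) : R * R :=
  (- x.2 / (2 * pi * norm2 x ^+ 2), x.1 / (2 * pi * norm2 x ^+ 2)).

Definition conv_integrand1 (a : R) (x y : R * R) : R :=
  (BS (x.1 - y.1, x.2 - y.2)).1 * omega_plus a y.
Definition conv_integrand2 (a : R) (x y : R * R) : R :=
  (BS (x.1 - y.1, x.2 - y.2)).2 * omega_plus a y.

Definition conv_defined (a : R) (x : R * R) : Prop :=
  leb2.-integrable setT (EFin \o conv_integrand1 a x) /\
  leb2.-integrable setT (EFin \o conv_integrand2 a x).

Definition u_plus (a : R) (x : R * R) : R * R :=
  (Rintegral leb2 setT (conv_integrand1 a x),
   Rintegral leb2 setT (conv_integrand2 a x)).

(* local integrability on R^2 (as in mathcomp-analysis' locally_integrable,
   with domain the whole plane) *)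
Definition locally_integrable2 (f : R * R -> R) : Prop :=
  measurable_fun setT f /\
  forall Kc : set (R * R), compact Kc ->
    (\int[leb2]_(x in Kc) `|f x|%:E < +oo)%E.

End defs.

(* Main.v *)
Require Import Defs.
From HB Require Import structures.
From mathcomp Require Import all_boot all_order all_algebra.
From mathcomp Require Import all_classical all_reals all_analysis.
From mathcomp Require Import measurable_realfun.
From mathcomp Require Import lra ring.
Import Order.TTheory GRing.Theory Num.Theory.
Import numFieldNormedType.Exports.
Local Open Scope classical_set_scope.
Local Open Scope ring_scope.

(** Both claims follow from a lower bound [b N^(1-a) - C] for the first velocity
    component at the points [x] of the dyadic square [cell N] (side [2^-(N+1)],
    at distance about [2^-N] from the origin).  Each square [cell k] with
    [3 <= k <= N - 2] lies above [x] and contributes at least a constant times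
    [k^-a] to the Biot-Savart integral, and these contributions add up to
    [N^(1-a)].  The negative part of the integrand lives on the strip
    [0 < y_2 < x_2] and has bounded integral: for [|y| <= 4 2^-N] it is at most
    [1 / (|x - y| |y|)], and farther away at most [16 2^-N / |y|^3]; both are
    summed over dyadic boxes, so that no polar coordinates are needed.  Finally
    [|u| omega^2] is at least a constant times [4^N N^(1-3a)] on [cell N], and for
    [a <= 2/3] its integrals over the cells dominate the harmonic series. *)

Section dyadic.
Variable R : realType.
Implicit Types (k m n N : nat) (t r : R) (c x y z : R * R).

(** * Dyadic scales *)

Definition dyad k : R := 2^-1 ^+ k.

Lemma dyad_gt0 k : 0 < dyad k. Proof. by rewrite exprn_gt0. Qed.

Lemma dyadS k : dyad k.+1 = dyad k / 2. Proof. by rewrite /dyad exprSr. Qed.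

Lemma dyad_mono m n : (m <= n)%N -> dyad n <= dyad m.
Proof. by move=> mn; apply: ler_wiXn2l => //; lra. Qed.

Lemma dyad_lt m n : dyad m < dyad n -> (n < m)%N.
Proof. by case: ltnP => // /dyad_mono; lra. Qed.

Lemma dyadVX k : (dyad k)^-1 = 2 ^+ k.
Proof. by rewrite /dyad exprVn invrK. Qed.

(** The least [n] with [dyad n < t] is positive, because [t <= dyad m <= 1]; its predecessor is the
    required [k]. *)
Lemma dyadic_scale t m : 0 < t -> t <= dyad m ->
  exists k, [/\ (m <= k)%N, dyad k.+1 < t & t <= dyad k].
Proof.
move=> t0 tm.
have ex : exists n, dyad n < t.
  (* For this [n], [2^n > n > 1/t]. *)
  exists (Num.truncn t^-1).+1.
  rewrite -[ltRHS]invrK -[ltLHS]invrK dyadVX ltf_pV2 ?posrE ?invr_gt0 ?exprn_gt0//.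
  apply: (lt_trans (truncnS_gt _)).
  by rewrite -natrX ltr_nat; apply: ltn_expl.
case: (ex_minnP ex) => -[|k] kt kmin.
  by have := dyad_mono _ _ (leq0n m); lra.
exists k; split => //; last first.
  by rewrite leNgt; apply/negP => /kmin; rewrite ltnn.
by rewrite -ltnS; apply: dyad_lt; lra.
Qed.

(** * Euclidean norm, boxes and diagonal cells *)

Lemma norm2_ge0 z : 0 <= norm2 z. Proof. exact: sqrtr_ge0. Qed.

Lemma norm2_sqr z : norm2 z ^+ 2 = z.1 ^+ 2 + z.2 ^+ 2.
Proof. by rewrite sqr_sqrtr// addr_ge0// sqr_ge0. Qed.

Lemma norm2_ge_fst z : `|z.1| <= norm2 z.
Proof. by rewrite -sqrtr_sqr ler_wsqrtr// lerDl sqr_ge0. Qed.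

Lemma norm2_ge_snd z : `|z.2| <= norm2 z.
Proof. by rewrite -sqrtr_sqr ler_wsqrtr// lerDr sqr_ge0. Qed.

Lemma norm2_le_sum z : norm2 z <= `|z.1| + `|z.2|.
Proof.
rewrite -(@ler_pXn2r _ 2)// ?nnegrE ?norm2_ge0 ?addr_ge0//.
by rewrite norm2_sqr sqrrD !real_normK ?num_real// addrAC lerDl mulrn_wge0 ?mulr_ge0.
Qed.

Definition dist2 c y := norm2 (c.1 - y.1, c.2 - y.2).

Lemma leb2X (i j : interval R) :
  @leb2 R ([set` i] `*` [set` j]) =
  (@lebesgue_measure R [set` i] * @lebesgue_measure R [set` j])%E.
Proof. by rewrite /leb2 product_measure1E//; exact: measurable_itv. Qed.

(** A ball of the maximum norm: it contains the Euclidean ball of radius [r], and its area is that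
    of a product of intervals. *)
Definition box c (r : R) : set (R * R) :=
  `[c.1 - r, c.1 + r]%classic `*` `[c.2 - r, c.2 + r]%classic.

Lemma measurable_box c r : measurable (box c r).
Proof. by apply: measurableX; exact: measurable_itv. Qed.

Lemma leb2_box c r : 0 < r -> @leb2 R (box c r) = (4 * r ^+ 2)%:E.
Proof.
move=> r0; rewrite leb2X !lebesgue_measure_itv/= !lte_fin.
rewrite ifT; last lra.
rewrite ifT; last lra.
by rewrite -!EFinD -EFinM; congr (_%:E); ring.
Qed.

Lemma dist2_box c y r : dist2 c y <= r -> box c r y.
Proof.
move=> h; have := norm2_ge_fst (c.1 - y.1, c.2 - y.2).
have := norm2_ge_snd (c.1 - y.1, c.2 - y.2); rewrite -/(dist2 c y) /= !ler_norml.
move=> /andP[? ?] /andP[? ?].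
by split; rewrite /= in_itv/=; apply/andP; split; lra.
Qed.

(** These squares lie along the diagonal and do not tile the quadrant, which suffices for lower
    bounds. Half-open sides make them disjoint. *)
Definition cell k : set (R * R) :=
  `]dyad k.+1, dyad k]%classic `*` `]dyad k.+1, dyad k]%classic.

Lemma measurable_cell k : measurable (cell k).
Proof. by apply: measurableX; exact: measurable_itv. Qed.

Lemma leb2_cell k : @leb2 R (cell k) = (dyad k.+1 ^+ 2)%:E.
Proof.
have k0 := dyad_gt0 k; have kS := dyadS k.
rewrite leb2X !lebesgue_measure_itv/= !lte_fin ifT; last lra.
by rewrite -!EFinD -EFinM; congr (_%:E); rewrite kS; field.
Qed.

Lemma cell_bounds k y : cell k y ->
  [/\ dyad k.+1 < y.1, y.1 <= dyad k, dyad k.+1 < y.2 & y.2 <= dyad k].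
Proof. by move=> [] /=; rewrite !in_itv/= => /andP[-> ->] /andP[-> ->]. Qed.

Lemma cell_inj j k y : cell j y -> cell k y -> j = k.
Proof.
move=> /cell_bounds[? ? _ _] /cell_bounds[? ? _ _]; apply/eqP.
rewrite eqn_leq; apply/andP; split; rewrite -ltnS; apply: dyad_lt; lra.
Qed.

(** * Comparison of integrals with dyadic sums *)

(** The cells are disjoint subsets of [D], so the step function equal to [v k] on [cell k] stays
    below [g]; [dyad k.+1 ^+ 2] is the area of [cell k]. *)
Lemma integral_ge_cells (D : set (R * R)) (g : R * R -> R) (v : nat -> R) m n :
  measurable D -> measurable_fun D g -> (forall y, D y -> 0 <= g y) ->
  (forall k, 0 <= v k) ->
  (forall k, (m <= k < n)%N -> cell k `<=` D) ->
  (forall k y, (m <= k < n)%N -> cell k y -> v k <= g y) ->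
  ((\sum_(m <= k < n) v k * dyad k.+1 ^+ 2)%:E <= \int[@leb2 R]_(y in D) (g y)%:E)%E.
Proof.
move=> mD mg g0 v0 cD vg.
have mI k : measurable_fun D (fun y => (v k * \1_(cell k) y)%:E).
  apply/measurable_EFinP; apply: measurable_funM => //.
  by apply: measurable_indic; exact: measurable_cell.
have I0 k y : D y -> (0 <= (v k * \1_(cell k) y)%:E)%E.
  by move=> _; rewrite lee_fin mulr_ge0.
apply: (@le_trans _ _ (\int[@leb2 R]_(y in D)
    (\sum_(k <- index_iota m n) (v k * \1_(cell k) y)%:E))%E).
  rewrite (ge0_integral_sum (@leb2 R) mD mI I0) -sumEFin.
  rewrite big_nat_cond [leRHS]big_nat_cond.
  apply: lee_sum => k; rewrite andbT => kmn.
  under eq_integral do rewrite EFinM.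
  rewrite ge0_integralZl_EFin//; last first.
    by apply/measurable_EFinP; apply: measurable_indic; exact: measurable_cell.
  rewrite integral_indic//; last exact: measurable_cell.
  by rewrite (setIidl (cD _ kmn)) EFinM -leb2_cell.
apply: ge0_le_integral => //.
- by move=> y Dy; apply: sume_ge0 => k _; exact: I0.
- by apply: emeasurable_sum => k; exact: mI.
- exact/measurable_EFinP.
move=> y Dy; rewrite sumEFin lee_fin.
(* By disjointness at most one term of the sum is nonzero at [y]. *)
have [[j [jmn cj]]|nc] := pselect (exists j, (m <= j < n)%N /\ cell j y).
  rewrite (bigD1_seq j)/= ?mem_index_iota ?iota_uniq// big1 ?addr0.
    by rewrite indicE mem_set// mulr1 vg.
  move=> i ij; rewrite indicE memNset ?mulr0// => ci.
  by move: ij; rewrite (cell_inj _ _ _ ci cj) eqxx.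
rewrite big_nat_cond big1 ?g0// => i; rewrite andbT => imn.
by rewrite indicE memNset ?mulr0// => ci; apply: nc; exists i.
Qed.

(** The boxes overlap, but all terms are nonnegative and at each point a single one already
    dominates [g]; the series is then integrated term by term. The alternative [g y = 0] covers the
    centre and the points outside the region of interest. *)
Lemma integral_le_boxes c (w : nat -> R) (g : R * R -> R) (M : R) :
  measurable_fun setT g -> (forall y, 0 <= g y) -> (forall k, 0 <= w k) ->
  (forall y, g y = 0 \/ exists2 k, box c (dyad k) y & g y <= w k) ->
  (forall n, \sum_(0 <= k < n) w k * (4 * dyad k ^+ 2) <= M) ->
  (\int[@leb2 R]_y (g y)%:E <= M%:E)%E.
Proof.
move=> mg g0 w0 gw wM.
have mI k : measurable_fun setT (fun y => (w k * \1_(box c (dyad k)) y)%:E).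
  apply/measurable_EFinP; apply: measurable_funM => //.
  by apply: measurable_indic; exact: measurable_box.
have I0 k y : setT y -> (0 <= (w k * \1_(box c (dyad k)) y)%:E)%E.
  by move=> _; rewrite lee_fin mulr_ge0.
apply: (@le_trans _ _ (\int[@leb2 R]_y
    (\sum_(k <oo) (w k * \1_(box c (dyad k)) y)%:E))%E).
  apply: ge0_le_integral => //.
  - by move=> y _; rewrite lee_fin.
  - exact/measurable_EFinP.
  - by apply: (@ge0_emeasurable_sum _ _ _ setT _ xpredT) => k *; [exact: I0|exact: mI].
  move=> y _; have [->|[k yk gk]] := gw y.
    by apply: nneseries_ge0 => k _ _; exact: I0.
  apply: (@le_trans _ _ (w k * \1_(box c (dyad k)) y)%:E).
    by rewrite lee_fin indicE mem_set// mulr1.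
  (* The partial sum through index [k] contains the dominating term. *)
  apply: (le_trans _ (@nneseries_lim_ge _ _ xpredT 0 k.+1 _)); last first.
    by move=> n _ _; exact: I0.
  by rewrite big_nat_recr//= leeDr// sume_ge0// => i _; exact: I0.
rewrite (integral_nneseries (@leb2 R) measurableT mI I0).
apply: lime_le.
  by apply: is_cvg_nneseries => k _ _; apply: integral_ge0 => y _; exact: I0.
apply: nearW => n.
apply: le_trans (_ : (_ <= (\sum_(0 <= k < n) w k * (4 * dyad k ^+ 2))%:E)%E) _; last first.
  by rewrite lee_fin.
rewrite -sumEFin; apply: lee_sum => k _.
under eq_integral do rewrite EFinM.
rewrite ge0_integralZl_EFin//; last first.
  by apply/measurable_EFinP; apply: measurable_indic; exact: measurable_box.
rewrite integral_indic//; last exact: measurable_box.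
by rewrite setIT EFinM -(leb2_box c) ?dyad_gt0.
Qed.

(** * Measurability of the vorticity and of the integrands *)

(** On nonnegative reals the inverse is the power with exponent -1, even at 0, where both are 0 by
    convention. *)
Lemma measurable_fun_inv_ge0 (f : R * R -> R) :
  measurable_fun setT f -> (forall y, 0 <= f y) ->
  measurable_fun setT (fun y => (f y)^-1).
Proof.
move=> mf f0; rewrite (_ : (fun _ => _) = (@powR R ^~ (-1)) \o f).
  by apply: measurableT_comp => //; exact: measurable_powR.
by apply/funext => y /=; rewrite powR_inv1.
Qed.

Lemma measurable_norm2 : measurable_fun setT (@norm2 R).
Proof.
apply: (@measurableT_comp _ _ _ _ _ _ (@Num.sqrt R)).
  by apply: continuous_measurable_fun; exact: sqrt_continuous.
by apply: measurable_funD; apply: measurable_funX;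
  [exact: measurable_fst|exact: measurable_snd].
Qed.

Lemma measurable_dist2 c : measurable_fun setT (dist2 c).
Proof.
apply: (measurableT_comp measurable_norm2).
apply/measurable_fun_pairP; split => /=.
  by apply: measurable_funB => //.
by apply: measurable_funB => //.
Qed.

Lemma dist2_ge0 c y : 0 <= dist2 c y. Proof. exact: norm2_ge0. Qed.

Lemma dist20 y : dist2 (0, 0) y = norm2 y.
Proof. by rewrite /dist2 /norm2 /= !sub0r !sqrrN. Qed.

Lemma measurable_omega_plus (a : R) : measurable_fun setT (@omega_plus R a).
Proof.
rewrite (_ : @omega_plus R a = fun x =>
    if (norm2 x < 3^-1) && (0 < x.2)
    then (norm2 x * (`|ln (norm2 x)| `^ a))^-1 else 0); last first.
  apply/funext => x; rewrite /omega_plus; congr (if _ then _ else _).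
  by apply/idP/idP; rewrite inE => /andP.
apply: measurable_fun_ifT => //.
  apply: measurable_and; apply: measurable_fun_ltr => //.
  exact: measurable_norm2.
apply: measurable_fun_inv_ge0; last first.
  by move=> y; rewrite mulr_ge0 ?norm2_ge0 ?powR_ge0.
apply: measurable_funM; first exact: measurable_norm2.
apply: (measurableT_comp (measurable_powR _)).
apply: measurableT_comp => //.
exact: (measurableT_comp (@measurable_ln _) measurable_norm2).
Qed.

Lemma measurable_conv_integrand1 (a : R) x :
  measurable_fun setT (conv_integrand1 a x).
Proof.
apply: measurable_funM; last exact: measurable_omega_plus.
apply: measurable_funM => /=.
  by apply: measurable_funN; apply: measurable_funB => //.
apply: measurable_fun_inv_ge0; last first.
  by move=> y; rewrite mulr_ge0 ?sqr_ge0// mulr_ge0 ?pi_ge0.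
apply: measurable_funM => //; apply: measurable_funX; exact: measurable_dist2.
Qed.

Lemma measurable_conv_integrand2 (a : R) x :
  measurable_fun setT (conv_integrand2 a x).
Proof.
apply: measurable_funM; last exact: measurable_omega_plus.
apply: measurable_funM => /=.
  by apply: measurable_funB => //.
apply: measurable_fun_inv_ge0; last first.
  by move=> y; rewrite mulr_ge0 ?sqr_ge0// mulr_ge0 ?pi_ge0.
apply: measurable_funM => //; apply: measurable_funX; exact: measurable_dist2.
Qed.

(** * Integrals of the two singular weights *)

Definition inv_near c m y : R := if dist2 c y <= dyad m then (dist2 c y)^-1 else 0.

(** The outer cut-off at 1 is harmless, since [omega_plus] is supported in the disc of radius
    1/3. *)
Definition inv3_far N y : R := if dyad N < norm2 y <= 1 then norm2 y ^- 3 else 0.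

Lemma inv_near_ge0 c m y : 0 <= inv_near c m y.
Proof. by rewrite /inv_near; case: ifP => // _; rewrite invr_ge0 dist2_ge0. Qed.

Lemma inv3_far_ge0 N y : 0 <= inv3_far N y.
Proof.
by rewrite /inv3_far; case: ifP => // _; rewrite invr_ge0 exprn_ge0 ?norm2_ge0.
Qed.

Lemma measurable_inv_near c m : measurable_fun setT (inv_near c m).
Proof.
apply: measurable_fun_ifT => //.
  by apply: measurable_fun_ler => //; exact: measurable_dist2.
by apply: measurable_fun_inv_ge0;
  [exact: measurable_dist2|exact: dist2_ge0].
Qed.

Lemma measurable_inv3_far N : measurable_fun setT (inv3_far N).
Proof.
apply: measurable_fun_ifT => //.
  by apply: measurable_and;
    [apply: measurable_fun_ltr|apply: measurable_fun_ler] => //;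
    exact: measurable_norm2.
apply: measurable_fun_inv_ge0; last by move=> y; rewrite exprn_ge0 ?norm2_ge0.
by apply: measurable_funX; exact: measurable_norm2.
Qed.

(** At distance between [2^-(k+1)] and [2^-k] from [c] the weight is at most [2^(k+1)], and the box
    has area [4 * 4^-k]. The products [8 * 2^-k] for [k >= m] sum to [16 * 2^-m]. *)
Lemma integral_inv_near c m :
  (\int[@leb2 R]_y (inv_near c m y)%:E <= (16 * dyad m)%:E)%E.
Proof.
apply: (integral_le_boxes c
  (fun k => if (m <= k)%N then (dyad k.+1)^-1 else 0)).
- exact: measurable_inv_near.
- exact: inv_near_ge0.
- by move=> k; case: ifP => // _; rewrite invr_ge0 ltW ?dyad_gt0.
- move=> y; rewrite /inv_near; case: ifPn => [ym|_]; last by left.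
  have [->|y0] := eqVneq (dist2 c y) 0; first by left; rewrite invr0.
  right; have {}y0 : 0 < dist2 c y by rewrite lt_neqAle eq_sym y0 dist2_ge0.
  have [k [mk ky yk]] := dyadic_scale _ _ y0 ym.
  exists k; first exact: dist2_box.
  by rewrite mk lef_pV2 ?posrE ?dyad_gt0// ltW.
- move=> n.
  (* The exact value of the partial geometric sum, in a form suited to induction on [n]. *)
  suff : \sum_(0 <= k < n) (if (m <= k)%N then (dyad k.+1)^-1 else 0) *
      (4 * dyad k ^+ 2) <= if (n <= m)%N then 0 else 16 * dyad m - 16 * dyad n.
    by move/le_trans; apply; have := dyad_gt0 m; have := dyad_gt0 n; case: ifP; lra.
  elim: n => [|n IH]; first by rewrite big_geq.
  rewrite big_nat_recr//=.
  have n0 := dyad_gt0 n; have nS := dyadS n.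
  case: (ltngtP n m) IH => [nm|mn|->] IH.
  + by rewrite mul0r addr0.
  + suff -> : (dyad n.+1)^-1 * (4 * dyad n ^+ 2) = 8 * dyad n by lra.
    by rewrite nS; field; rewrite gt_eqF.
  + suff -> : (dyad m.+1)^-1 * (4 * dyad m ^+ 2) = 8 * dyad m.
      by have := dyadS m; lra.
    by rewrite dyadS; field; rewrite gt_eqF ?dyad_gt0.
Qed.

(** At scale [k < N] the weight is at most [8^(k+1)] on a box of area [4 * 4^-k]. The products
    [32 * 2^k] sum to less than [32 * 2^N]. *)
Lemma integral_inv3_far N :
  (\int[@leb2 R]_y (inv3_far N y)%:E <= (32 / dyad N)%:E)%E.
Proof.
apply: (integral_le_boxes (0, 0)
  (fun k => if (k < N)%N then dyad k.+1 ^- 3 else 0)).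
- exact: measurable_inv3_far.
- exact: inv3_far_ge0.
- by move=> k; case: ifP => // _; rewrite invr_ge0 exprn_ge0 ?ltW ?dyad_gt0.
- move=> y; rewrite /inv3_far; case: ifPn => [/andP[Ny y1]|_]; last by left.
  right; have y0 : 0 < norm2 y by apply: lt_trans Ny; exact: dyad_gt0.
  have [k [_ ky yk]] := dyadic_scale _ 0 y0 y1.
  exists k; first by apply: dist2_box; rewrite dist20.
  rewrite dyad_lt; last by apply: lt_le_trans yk.
  rewrite lef_pV2 ?posrE ?exprn_gt0 ?dyad_gt0//.
  by rewrite lerXn2r ?nnegrE ?norm2_ge0// ltW ?dyad_gt0.
- move=> n.
  (* The minimum records that the sum stops growing at [n = N]; before that each step doubles the
     bound. *)
  suff : \sum_(0 <= k < n) (if (k < N)%N then dyad k.+1 ^- 3 else 0) *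
      (4 * dyad k ^+ 2) <= 32 / dyad (minn n N).
    move/le_trans; apply; rewrite ler_pM2l// lef_pV2 ?posrE ?dyad_gt0//.
    by apply: dyad_mono; exact: geq_minr.
  elim: n => [|n IH]; first by rewrite big_geq// divr_ge0// ltW ?dyad_gt0.
  rewrite big_nat_recr//=.
  have n0 := dyad_gt0 n; have nS := dyadS n.
  case: ltnP IH => [nN|Nn] IH; last first.
    by rewrite mul0r addr0 (minn_idPr (leqW Nn)).
  rewrite (minn_idPl nN) nS.
  apply: (le_trans (lerD IH (lexx _))).
  by rewrite le_eqVlt; apply/orP; left; apply/eqP; field; rewrite gt_eqF.
Qed.

(** * Pointwise bounds on the vorticity *)

(** This amounts to [1/3 <= 1/e]. It allows the logarithm to be dropped from upper bounds on
    [omega_plus]. *)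
Lemma ln_norm_ge1 t : 0 < t -> t < 3^-1 -> 1 <= `|ln t|.
Proof.
move=> t0 t3; rewrite ler_normr; apply/orP; right.
suff : ln t <= -1 by lra.
rewrite -[leRHS]expRK ler_ln ?posrE ?expR_gt0//.
apply: (le_trans (ltW t3)).
(* From [1 + x <= e^x] at [x = -1/6], [1/e >= (5/6)^6], which just exceeds 1/3. *)
have -> : -1 = 6%:R * (- 6^-1) :> R by field.
rewrite expRM_natl.
have e6 : 5 / 6 <= expR (- 6^-1) :> R by apply: le_trans (expR_ge1Dx _); lra.
apply: (@le_trans _ _ ((5 / 6) ^+ 6)); first by lra.
by rewrite lerXn2r ?nnegrE ?expR_ge0//; lra.
Qed.

Lemma omega_plusN (a : R) y : ~ @Bplus R y -> omega_plus a y = 0.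
Proof. by move=> yB; rewrite /omega_plus memNset. Qed.

Lemma Bplus_norm2_gt0 y : @Bplus R y -> 0 < norm2 y.
Proof.
by move=> [_ y2]; apply: lt_le_trans (norm2_ge_snd y); rewrite normr_gt0 gt_eqF.
Qed.

Lemma omega_plus_ge0 (a : R) y : 0 <= omega_plus a y.
Proof.
rewrite /omega_plus; case: ifP => // _.
by rewrite invr_ge0 mulr_ge0 ?norm2_ge0 ?powR_ge0.
Qed.

Lemma omega_plus_le (a : R) y : 0 <= a -> omega_plus a y <= (norm2 y)^-1.
Proof.
move=> a0; have [yB|/omega_plusN->] := pselect (@Bplus R y); last first.
  by rewrite invr_ge0 norm2_ge0.
have n0 := Bplus_norm2_gt0 _ yB.
rewrite /omega_plus mem_set//.
have p1 : 1 <= `|ln (norm2 y)| `^ a.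
  by rewrite -(powRr0 `|ln (norm2 y)|); apply: ler_powR => //;
    apply: ln_norm_ge1 => //; case: yB.
rewrite lef_pV2 ?posrE ?mulr_gt0 ?(lt_le_trans _ p1)//.
by rewrite ler_peMr// ltW.
Qed.

Lemma cell_norm2 k y : cell k y -> dyad k.+1 < norm2 y /\ norm2 y <= 2 * dyad k.
Proof.
move=> /cell_bounds[? ? ? ?]; have k0 := dyad_gt0 k.+1.
have := norm2_le_sum y; have := norm2_ge_fst y.
by rewrite (@gtr0_norm _ y.1) ?(@gtr0_norm _ y.2); [split; lra|lra|lra].
Qed.

(** On [cell k], [|y| <= 2 * 2^-k] and [|ln |y|| <= (k+1) ln 2 <= 2k], while [(2k)^a <= 2 k^a]
    because [a < 1]. The condition [k >= 3] gives [|y| <= 1/4], so the cell lies in the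
    half-disc. *)
Lemma omega_plus_cell_ge (a : R) k y : 0 < a < 1 -> (3 <= k)%N -> cell k y ->
  (4 * dyad k * k%:R `^ a)^-1 <= omega_plus a y.
Proof.
move=> /andP[a0 a1] k3 ky.
have [yl yu] := cell_norm2 _ _ ky; have k0 := dyad_gt0 k.+1.
have k8 : dyad k <= 8^-1 by apply: le_trans (dyad_mono _ _ k3) _; rewrite /dyad; lra.
have n0 : 0 < norm2 y by lra.
have n3 : norm2 y < 3^-1 by lra.
have yB : @Bplus R y by split => //; have [_ _ ? _] := cell_bounds _ _ ky; lra.
have kR : 3%:R <= k%:R :> R by rewrite ler_nat.
have lnu : `|ln (norm2 y)| <= 2 * k%:R.
  rewrite ler0_norm; last by apply: ln_le0; lra.
  apply: (@le_trans _ _ (- ln (dyad k.+1))).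
    by rewrite lerN2 ler_ln ?posrE// ltW.
  rewrite /dyad lnXn// lnV ?posrE// mulNrn opprK.
  have ln2 : ln 2 <= 1 :> R.
    by have -> : 2 = 1 + 1 :> R; [lra|apply: le_ln1Dx; lra].
  apply: (@le_trans _ _ (1 *+ k.+1)); first by rewrite ler_wMn2r.
  by rewrite -natr1; lra.
have pw : `|ln (norm2 y)| `^ a <= 2 * k%:R `^ a.
  apply: (@le_trans _ _ ((2 * k%:R) `^ a)).
    by apply: ge0_ler_powR => //; rewrite ?nnegrE//; lra.
  rewrite powRM ?ler_wpM2r ?powR_ge0//.
  by rewrite -[leRHS]powRr1//; apply: ler_powR; lra.
rewrite /omega_plus mem_set//.
have l1 := ln_norm_ge1 _ n0 n3.
have p0 : 0 < `|ln (norm2 y)| `^ a by apply: powR_gt0; lra.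
have q0 : 0 < k%:R `^ a :> R by apply: powR_gt0; lra.
rewrite lef_pV2 ?posrE ?mulr_gt0 ?dyad_gt0//.
apply: (@le_trans _ _ ((2 * dyad k) * (2 * k%:R `^ a))); last by lra.
by apply: ler_pM => //; apply: ltW.
Qed.

(** * Pointwise bounds on the Biot-Savart integrand *)

Lemma BS_le z : `|(BS z).1| <= (norm2 z)^-1 /\ `|(BS z).2| <= (norm2 z)^-1.
Proof.
have pi2 := pi_ge2 R.
have aux (b : R) : `|b| <= norm2 z -> `|b / (2 * pi * norm2 z ^+ 2)| <= (norm2 z)^-1.
  (* At the singularity both sides are 0, by the convention for the inverse of 0. *)
  move=> bz; have [z0|z0] := eqVneq (norm2 z) 0.
    by rewrite z0 expr0n/= mulr0 invr0 mulr0 normr0.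
  have {}z0 : 0 < norm2 z by rewrite lt_neqAle eq_sym z0 norm2_ge0.
  have d0 : 0 < 2 * pi * norm2 z ^+ 2 by rewrite mulr_gt0 ?exprn_gt0//; lra.
  rewrite normrM normfV (gtr0_norm d0) ler_pdivrMr//.
  apply: (le_trans bz).
  have -> : (norm2 z)^-1 * (2 * pi * norm2 z ^+ 2) = 2 * pi * norm2 z.
    by field; rewrite gt_eqF.
  by rewrite ler_peMl; lra.
split; apply: aux; last exact: norm2_ge_fst.
by rewrite normrN; exact: norm2_ge_snd.
Qed.

Lemma conv_integrand_le (a : R) x y : 0 <= a ->
  `|conv_integrand1 a x y| <= (dist2 x y)^-1 * omega_plus a y /\
  `|conv_integrand2 a x y| <= (dist2 x y)^-1 * omega_plus a y.
Proof.
move=> a0; have [b1 b2] := BS_le (x.1 - y.1, x.2 - y.2).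
by split; rewrite normrM (ger0_norm (omega_plus_ge0 _ _)) ler_wpM2r ?omega_plus_ge0.
Qed.

(* Partial fractions: [p + q >= d] gives [1 / (p q) <= (1 / p + 1 / q) / d]. *)
Lemma inv_dist2_norm2_le N x y : cell N x ->
  (dist2 x y)^-1 * (norm2 y)^-1 <=
  (dyad N.+1)^-1 * ((norm2 y)^-1 + (dist2 x y)^-1).
Proof.
move=> /cell_bounds[x1 _ _ _]; have d0 := dyad_gt0 N.+1.
have rhs0 : 0 <= (dyad N.+1)^-1 * ((norm2 y)^-1 + (dist2 x y)^-1).
  by rewrite mulr_ge0 ?addr_ge0 ?invr_ge0 ?norm2_ge0 ?dist2_ge0 ?ltW.
have [p0|p0] := eqVneq (dist2 x y) 0; first by rewrite {1}p0 invr0 mul0r.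
have [q0|q0] := eqVneq (norm2 y) 0; first by rewrite {1}q0 invr0 mulr0.
have {}p0 : 0 < dist2 x y by rewrite lt_neqAle eq_sym p0 dist2_ge0.
have {}q0 : 0 < norm2 y by rewrite lt_neqAle eq_sym q0 norm2_ge0.
have := norm2_ge_fst (x.1 - y.1, x.2 - y.2); rewrite -/(dist2 x y) /= => h1.
have h2 := norm2_ge_fst y.
have h3 := ler_norm (x.1 - y.1); have h4 := ler_norm y.1.
have -> : (dist2 x y)^-1 * (norm2 y)^-1 =
    (dyad N.+1)^-1 * ((dyad N.+1) / (dist2 x y * norm2 y)).
  by field; rewrite !gt_eqF.
have -> : (norm2 y)^-1 + (dist2 x y)^-1 = (dist2 x y + norm2 y) / (dist2 x y * norm2 y).
  by field; rewrite !gt_eqF.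
rewrite ler_wpM2l ?invr_ge0 ?(ltW d0)// ler_wpM2r ?invr_ge0 ?mulr_ge0 ?ltW//.
lra.
Qed.

(** The two cut-off radii are independent: both are 1 for integrability, while they follow the scale
    of [x] for the negative part. *)
Lemma conv_integrand_near_le (a : R) N m n x y : 0 <= a -> cell N x ->
  norm2 y <= dyad m -> dist2 x y <= dyad n ->
  `|conv_integrand1 a x y| <=
    (dyad N.+1)^-1 * (inv_near (0, 0) m y + inv_near x n y) /\
  `|conv_integrand2 a x y| <=
    (dyad N.+1)^-1 * (inv_near (0, 0) m y + inv_near x n y).
Proof.
move=> a0 xN ym xyn; rewrite /inv_near dist20 ym xyn.
have [h1 h2] := conv_integrand_le _ x y a0.
suff h : (dist2 x y)^-1 * omega_plus a y <=
    (dyad N.+1)^-1 * ((norm2 y)^-1 + (dist2 x y)^-1).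
  by split; [exact: le_trans h1 h|exact: le_trans h2 h].
apply: le_trans (inv_dist2_norm2_le _ _ _ xN).
by rewrite ler_wpM2l ?invr_ge0 ?dist2_ge0// omega_plus_le.
Qed.

Lemma inv_near_sum_ge0 N m n x y :
  0 <= (dyad N.+1)^-1 * (inv_near (0, 0) m y + inv_near x n y).
Proof. by rewrite mulr_ge0 ?invr_ge0 ?addr_ge0 ?inv_near_ge0 ?(ltW (dyad_gt0 _)). Qed.

Lemma dist2_le_sum x y : dist2 x y <= `|x.1| + `|y.1| + (`|x.2| + `|y.2|).
Proof.
by apply: le_trans (norm2_le_sum _) _; rewrite lerD// ler_normB.
Qed.

(** On the half-disc [|y| < 1/3], and [|x - y| <= 1/8 + 1/8 + 2/3 < 1], so neither cut-off at radius
    1 takes effect. *)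
Lemma conv_integrand_le_global (a : R) N x y : 0 <= a -> (3 <= N)%N -> cell N x ->
  `|conv_integrand1 a x y| <=
    (dyad N.+1)^-1 * (inv_near (0, 0) 0 y + inv_near x 0 y) /\
  `|conv_integrand2 a x y| <=
    (dyad N.+1)^-1 * (inv_near (0, 0) 0 y + inv_near x 0 y).
Proof.
move=> a0 N3 xN; have [yB|yB] := pselect (@Bplus R y); last first.
  rewrite /conv_integrand1 /conv_integrand2 omega_plusN// !mulr0 normr0.
  by have := inv_near_sum_ge0 N 0 0 x y.
have [y3 _] := yB.
apply: conv_integrand_near_le => //; rewrite /dyad expr0; first lra.
have N8 : dyad N <= 8^-1 by apply: le_trans (dyad_mono _ _ N3) _; rewrite /dyad; lra.
have [? ? ? ?] := cell_bounds _ _ xN; have := dyad_gt0 N.+1 => ?.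
have := dist2_le_sum x y; have := norm2_ge_fst y; have := norm2_ge_snd y.
rewrite (@gtr0_norm _ x.1); last lra.
rewrite (@gtr0_norm _ x.2); last lra.
lra.
Qed.

(* The two terms dominate the negative part of the integrand on [|y| <= 4 2^-(N+4)]
   and on its complement. *)
Definition neg_majorant N x y : R :=
  (dyad N.+4.+1)^-1 * (inv_near (0, 0) N.+2 y + inv_near x N y) +
  16 * dyad N.+4 * inv3_far N.+4 y.

Lemma neg_majorant_ge0 N x y : 0 <= neg_majorant N x y.
Proof.
rewrite addr_ge0 ?inv_near_sum_ge0// mulr_ge0 ?inv3_far_ge0//.
by have := dyad_gt0 N.+4; lra.
Qed.

Lemma conv_integrand1_sign (a : R) x y : x.2 <= y.2 -> 0 <= conv_integrand1 a x y.
Proof.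
move=> xy; rewrite /conv_integrand1 mulr_ge0 ?omega_plus_ge0//=.
apply: divr_ge0; first lra.
by rewrite mulr_ge0 ?sqr_ge0// mulr_ge0 ?pi_ge0.
Qed.

(** The integrand can be negative only for [0 < y.2 < x.2]. Writing the index as [N.+4] makes the
    threshold [4 * dyad N.+4] equal to [dyad N.+2]; below it [|x - y| <= dyad N]. *)
Lemma conv_integrand1_ge (a : R) N x y : 0 <= a -> cell N.+4 x ->
  - neg_majorant N x y <= conv_integrand1 a x y.
Proof.
move=> a0 xN; have h0 := neg_majorant_ge0 N x y.
have [yB|yB] := pselect (@Bplus R y); last first.
  by rewrite /conv_integrand1 omega_plusN// mulr0; lra.
have [xy|yx] := leP x.2 y.2; first by have := conv_integrand1_sign a _ _ xy; lra.
have [x1l x1u x2l x2u] := cell_bounds _ _ xN.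
have N0 := dyad_gt0 N; have N4 : dyad N.+4 = dyad N / 16 by rewrite !dyadS; field.
have N5 := dyadS N.+4.
have N2 : dyad N.+2 = dyad N / 4 by rewrite !dyadS; field.
have e1 : `|x.1| = x.1 by rewrite gtr0_norm//; lra.
have e2 : `|x.2| = x.2 by rewrite gtr0_norm//; lra.
have yn1 := norm2_ge_fst y; have yn2 := norm2_ge_snd y.
suff : `|conv_integrand1 a x y| <= neg_majorant N x y by rewrite ler_norml => /andP[].
have [near|far] := leP (norm2 y) (dyad N.+2).
  have dN : dist2 x y <= dyad N.
    by have := dist2_le_sum x y; rewrite e1 e2; lra.
  have [+ _] := conv_integrand_near_le _ _ _ _ _ _ a0 xN near dN.
  move/le_trans; apply; rewrite lerDl mulr_ge0 ?inv3_far_ge0//; lra.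
have [y3 y2] := yB.
have y0 : 0 < norm2 y by lra.
(* Since [|y| <= |x.1| + |x.2| + 2 |x - y|] and [|x.1| + |x.2| <= 2 dyad N.+4 < |y| / 2]. *)
have d4 : norm2 y / 4 <= dist2 x y.
  have := norm2_ge_fst (x.1 - y.1, x.2 - y.2).
  have := norm2_ge_snd (x.1 - y.1, x.2 - y.2); rewrite -/(dist2 x y) /=.
  have := ler_normB x.1 (x.1 - y.1); have := ler_normB x.2 (x.2 - y.2).
  rewrite !subKr e1 e2.
  by have := norm2_le_sum y; lra.
apply: (@le_trans _ _ (16 * dyad N.+4 * inv3_far N.+4 y)); last first.
  by rewrite lerDr inv_near_sum_ge0.
rewrite /inv3_far ifT; last by apply/andP; split; lra.
rewrite /conv_integrand1 normrM (ger0_norm (omega_plus_ge0 _ _)).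
apply: (@le_trans _ _ ((16 * dyad N.+4 / norm2 y ^+ 2) * (norm2 y)^-1)); last first.
  by rewrite le_eqVlt; apply/orP; left; apply/eqP; field; rewrite gt_eqF.
apply: ler_pM => //; [exact: omega_plus_ge0| |exact: omega_plus_le].
(* The numerator [x.2 - y.2] is at most [x.2 <= dyad N.+4]; this gain yields the cubic decay. *)
rewrite /BS/= -/(dist2 x y).
have d0 : 0 < dist2 x y by lra.
have pi2 := pi_ge2 R.
have den0 : 0 < 2 * pi * dist2 x y ^+ 2 by rewrite mulr_gt0 ?exprn_gt0//; lra.
rewrite normrM normrN normfV (gtr0_norm den0) gtr0_norm; last lra.
rewrite ler_pdivrMr// mulrAC ler_pdivlMr ?exprn_gt0//.
apply: (@le_trans _ _ (dyad N.+4 * (16 * dist2 x y ^+ 2))).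
  apply: ler_pM; [lra|exact: sqr_ge0|lra|].
  have -> : 16 * dist2 x y ^+ 2 = (4 * dist2 x y) ^+ 2 by ring.
  by rewrite lerXn2r ?nnegrE//; lra.
have -> : dyad N.+4 * (16 * dist2 x y ^+ 2) = 16 * dyad N.+4 * dist2 x y ^+ 2 by ring.
have -> : 16 * dyad N.+4 * (2 * pi * dist2 x y ^+ 2) =
  (2 * pi) * (16 * dyad N.+4 * dist2 x y ^+ 2) by ring.
rewrite ler_peMl//; last lra.
by rewrite mulr_ge0 ?sqr_ge0//; lra.
Qed.

(** Here [y.2 - x.2 >= dyad k / 4], [|x - y| <= 2 dyad k] and [2 pi <= 8], so the kernel is at least
    [1 / (128 dyad k)]; the other factor is the lower bound on [omega_plus]. *)
Lemma conv_integrand1_cell_ge (a : R) N k x y : 0 < a < 1 ->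
  (3 <= k < N.+3)%N -> cell N.+4 x -> cell k y ->
  (512 * dyad k ^+ 2 * k%:R `^ a)^-1 <= conv_integrand1 a x y.
Proof.
move=> a01 /andP[k3 kN] xN yk.
have [x1l x1u x2l x2u] := cell_bounds _ _ xN.
have [y1l y1u y2l y2u] := cell_bounds _ _ yk.
have k0 := dyad_gt0 k; have N0 := dyad_gt0 N.+4.+1; have kS := dyadS k.
(* The range [k < N.+3] keeps [y] at least two scales above [x]. *)
have kN' : dyad N.+4 <= dyad k / 4.
  have -> : dyad k / 4 = dyad k.+2 by rewrite !dyadS; field.
  exact: dyad_mono.
have om := omega_plus_cell_ge _ _ _ a01 k3 yk.
have pi2 := pi_ge2 R.
have pi4 : pi <= 4 :> R by have := pihalf_lt2 R; lra.
have h2 := norm2_ge_snd (x.1 - y.1, x.2 - y.2).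
have du : dist2 x y <= 2 * dyad k.
  have := norm2_le_sum (x.1 - y.1, x.2 - y.2); rewrite -/(dist2 x y) /=.
  rewrite (@ler0_norm _ (x.1 - y.1)); last lra.
  by rewrite (@ler0_norm _ (x.2 - y.2)); lra.
have d0 : 0 < dist2 x y.
  by move: h2; rewrite -/(dist2 x y)/= (@ler0_norm _ (x.2 - y.2)); lra.
have p0 : 0 < k%:R `^ a :> R by apply: powR_gt0; rewrite ltr0n (leq_trans _ k3).
apply: (@le_trans _ _ ((128 * dyad k)^-1 * (4 * dyad k * k%:R `^ a)^-1)).
  by rewrite le_eqVlt; apply/orP; left; apply/eqP; field; rewrite !gt_eqF.
rewrite /conv_integrand1; apply: ler_pM => //.
- by rewrite invr_ge0; lra.
- by rewrite invr_ge0 mulr_ge0 ?ltW//; lra.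
rewrite /BS/= -/(dist2 x y).
have den0 : 0 < 2 * pi * dist2 x y ^+ 2 by rewrite mulr_gt0 ?exprn_gt0//; lra.
rewrite ler_pdivlMr// ler_pdivrMl; last lra.
apply: (@le_trans _ _ (8 * (2 * dyad k) ^+ 2)).
  apply: ler_pM; [lra|exact: sqr_ge0|lra|].
  by rewrite lerXn2r ?nnegrE//; lra.
have -> : 8 * (2 * dyad k) ^+ 2 = 128 * dyad k * (dyad k / 4) by field.
by rewrite ler_pM2l; lra.
Qed.

(** * Integrability and growth of the velocity *)

Lemma integrable_ge0_le (g : R * R -> R) (M : R) : measurable_fun setT g ->
  (forall y, 0 <= g y) -> (\int[@leb2 R]_y (g y)%:E <= M%:E)%E ->
  (@leb2 R).-integrable setT (EFin \o g).
Proof.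
move=> mg g0 gM; apply/integrableP; split; first exact/measurable_EFinP.
under eq_integral do rewrite gee0_abs ?lee_fin//.
exact: le_lt_trans gM (ltry _).
Qed.

Lemma measurable_neg_majorant N x : measurable_fun setT (neg_majorant N x).
Proof.
apply: measurable_funD; apply: measurable_funM => //.
  by apply: measurable_funD; exact: measurable_inv_near.
exact: measurable_inv3_far.
Qed.

Lemma integral_inv_near_sum N m n x :
  (\int[@leb2 R]_y ((dyad N)^-1 * (inv_near (0, 0) m y + inv_near x n y))%:E <=
   ((dyad N)^-1 * (16 * dyad m + 16 * dyad n))%:E)%E.
Proof.
have mE c k : measurable_fun setT (EFin \o inv_near c k).
  by apply/measurable_EFinP; exact: measurable_inv_near.
have ge0 c k y : (0 <= (EFin \o inv_near c k) y)%E by rewrite lee_fin inv_near_ge0.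
under eq_integral do rewrite EFinM EFinD.
rewrite ge0_integralZl_EFin//; last 3 first.
- by move=> y _; rewrite -EFinD lee_fin addr_ge0 ?inv_near_ge0.
- by apply: emeasurable_funD; exact: mE.
- by rewrite invr_ge0 ltW ?dyad_gt0.
rewrite ge0_integralD//; last 4 first.
- by move=> y _; exact: ge0.
- exact: mE.
- by move=> y _; exact: ge0.
- exact: mE.
rewrite EFinM EFinD.
apply: lee_wpmul2l; first by rewrite lee_fin invr_ge0 ltW ?dyad_gt0.
by apply: leeD; exact: integral_inv_near.
Qed.

(** The bound is scale invariant: the near part gives [32 * (4 + 16) = 640] and the far part
    [16 * 32 = 512]. *)
Lemma integral_neg_majorant N x :
  (\int[@leb2 R]_y (neg_majorant N x y)%:E <= 1152%:E)%E.
Proof.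
have N0 := dyad_gt0 N.
under eq_integral do rewrite EFinD.
rewrite ge0_integralD//; last 4 first.
- by move=> y _; rewrite lee_fin inv_near_sum_ge0.
- apply/measurable_EFinP; apply: measurable_funM => //.
  by apply: measurable_funD; exact: measurable_inv_near.
- by move=> y _; rewrite lee_fin mulr_ge0 ?inv3_far_ge0// mulr_ge0 ?(ltW (dyad_gt0 _)).
- by apply/measurable_EFinP; apply: measurable_funM => //; exact: measurable_inv3_far.
under [X in (_ + X <= _)%E]eq_integral do rewrite EFinM.
rewrite ge0_integralZl_EFin//; last 3 first.
- by move=> y _; rewrite lee_fin inv3_far_ge0.
- by apply/measurable_EFinP; exact: measurable_inv3_far.
- by rewrite mulr_ge0 ?(ltW (dyad_gt0 _)).
apply: le_trans (_ : (_ <= ((dyad N.+4.+1)^-1 * (16 * dyad N.+2 + 16 * dyad N))%:E +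
    (16 * dyad N.+4)%:E * (32 / dyad N.+4)%:E)%E) _.
  apply: leeD; first exact: integral_inv_near_sum.
  apply: lee_wpmul2l; last exact: integral_inv3_far.
  by rewrite lee_fin mulr_ge0 ?(ltW (dyad_gt0 _)).
rewrite -EFinM -EFinD lee_fin le_eqVlt; apply/orP; left; apply/eqP.
by rewrite !dyadS; field; rewrite gt_eqF.
Qed.

Lemma conv_defined_cell (a : R) N x : 0 <= a -> (3 <= N)%N -> cell N x ->
  conv_defined a x.
Proof.
move=> a0 N3 xN.
pose G y := (dyad N.+1)^-1 * (inv_near (0, 0) 0 y + inv_near x 0 y).
have G0 y : 0 <= G y by exact: inv_near_sum_ge0.
have iG : (@leb2 R).-integrable setT (EFin \o G).
  apply: integrable_ge0_le (integral_inv_near_sum _ _ _ _) => //.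
  apply: measurable_funM => //.
  by apply: measurable_funD; exact: measurable_inv_near.
split; apply: le_integrable iG => //.
- by apply/measurable_EFinP; exact: measurable_conv_integrand1.
- move=> y _; rewrite /= lee_fin (ger0_norm (G0 y)).
  by have [] := conv_integrand_le_global _ _ _ y a0 N3 xN.
- by apply/measurable_EFinP; exact: measurable_conv_integrand2.
- move=> y _; rewrite /= lee_fin (ger0_norm (G0 y)).
  by have [] := conv_integrand_le_global _ _ _ y a0 N3 xN.
Qed.

(** Adding the majorant makes the integrand nonnegative, so its integral can be bounded below by
    cells alone; the majorant then costs at most 1152. *)
Lemma u_plus_cell_ge (a : R) N x : 0 < a < 1 -> (8 <= N)%N -> cell N x ->
  N%:R `^ (1 - a) / 4096 - 1152 <= (u_plus a x).1.
Proof.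
move=> a01; have /andP[a0 a1] := a01.
case: N => // -[//|[//|[//|N]]] N4 xN.
have [if1 _] := conv_defined_cell _ _ _ (ltW a0) (isT : 3 <= N.+4)%N xN.
have mf := measurable_conv_integrand1 a x.
have mh := measurable_neg_majorant N x.
have ih : (@leb2 R).-integrable setT (EFin \o neg_majorant N x).
  by apply: integrable_ge0_le (integral_neg_majorant N x) => // y;
    exact: neg_majorant_ge0.
pose v k : R := (512 * dyad k ^+ 2 * k%:R `^ a)^-1.
have v0 k : 0 <= v k.
  rewrite invr_ge0; apply: mulr_ge0; last exact: powR_ge0.
  by apply: mulr_ge0; [exact: ler0n|exact: sqr_ge0].
have : ((\sum_(3 <= k < N.+3) v k * dyad k.+1 ^+ 2)%:E <=
    \int[@leb2 R]_y (conv_integrand1 a x y + neg_majorant N x y)%:E)%E.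
  apply: integral_ge_cells => //.
  - exact: measurable_funD.
  - by move=> y _; have := conv_integrand1_ge a N x y (ltW a0) xN; lra.
  - move=> k y k3 ky.
    have := conv_integrand1_cell_ge _ _ _ _ _ a01 k3 xN ky.
    by have := neg_majorant_ge0 N x y; rewrite /v; lra.
under eq_integral do rewrite EFinD.
rewrite integralD// -(fineK (integrable_fin_num measurableT if1)).
move=> /le_trans => /(_ _ (leeD (lexx _) (integral_neg_majorant N x))).
rewrite -EFinD lee_fin -/(Rintegral _ _ _) /u_plus/=.
suff : N.+4%:R `^ (1 - a) / 4096 <= \sum_(3 <= k < N.+3) v k * dyad k.+1 ^+ 2.
  by rewrite /Rintegral /=; lra.
have M8 : 8 <= N.+4%:R :> R by rewrite ler_nat.
have p0 : 0 < N.+4%:R `^ a :> R by apply: powR_gt0; lra.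
(* Each [k^-a] is replaced by the smaller [(N+4)^-a]. There are [N] terms, and [N >= (N+4)/2]
   because [N+4 >= 8]. *)
apply: (@le_trans _ _ (\sum_(3 <= k < N.+3) 2048^-1 * (N.+4%:R `^ a)^-1)).
  rewrite big_const_nat iter_addr_0 subSS subn2/= -[leRHS]mulr_natr.
  have -> : N.+4%:R `^ (1 - a) = N.+4%:R / N.+4%:R `^ a :> R.
    by rewrite powRB ?powRr1//; apply/implyP => _; rewrite gt_eqF//; lra.
  have NE : N%:R = N.+4%:R - 4 :> R by rewrite -addn4 natrD addrK.
  rewrite NE [leRHS]mulrC mulrA [leLHS]mulrAC ler_wpM2r ?invr_ge0 ?(ltW p0)//.
  lra.
rewrite big_nat_cond [leRHS]big_nat_cond; apply: ler_sum => k.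
rewrite andbT => /andP[k3 kN].
have k0 := dyad_gt0 k.
have kR : 0 < k%:R :> R by rewrite ltr0n (leq_trans _ k3).
have q0 : 0 < k%:R `^ a :> R by apply: powR_gt0.
have -> : v k * dyad k.+1 ^+ 2 = 2048^-1 * (k%:R `^ a)^-1.
  by rewrite /v dyadS; field; rewrite !gt_eqF.
apply: ler_wpM2l; first by rewrite invr_ge0 ler0n.
rewrite lef_pV2 ?posrE//.
by apply: ge0_ler_powR; rewrite ?nnegrE ?ler_nat ?(ltW a0)// ltnW// ltnW.
Qed.

Lemma u_plus_cell_growth (a : R) : 0 < a < 1 ->
  exists b C : R, 0 < b /\ forall N x, (8 <= N)%N -> cell N x ->
    b * N%:R `^ (1 - a) - C <= (u_plus a x).1.
Proof.
move=> a01; exists 4096^-1, 1152; split; first by rewrite invr_gt0 ltr0n.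
by move=> N x N8 xN; rewrite mulrC; exact: u_plus_cell_ge.
Qed.

(** * Unboundedness of the velocity *)

Lemma powR_nat_unbounded (b B : R) : 0 < b ->
  exists N0, forall N, (N0 <= N)%N -> B <= N%:R `^ b.
Proof.
move=> b0; exists (Num.truncn (`|B| `^ b^-1)).+1 => N N0N.
apply: (le_trans (ler_norm B)).
have -> : `|B| = (`|B| `^ b^-1) `^ b by rewrite -powRrM mulVf ?gt_eqF// powRr1.
apply: ge0_ler_powR; rewrite ?nnegrE ?powR_ge0 ?(ltW b0)//.
by apply: le_trans (ltW (truncnS_gt _)) _; rewrite ler_nat.
Qed.

Lemma cell_nonempty N : cell N (dyad N, dyad N).
Proof.
by split; rewrite /= in_itv/= lexx andbT; have := dyad_gt0 N; have := dyadS N; lra.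
Qed.

(** The upper right corner of a cell of large index serves as [x]. The clause [conv_defined] ensures
    that the value there is an absolutely convergent integral and not a default. *)
Lemma u_plus_unbounded (a M : R) : 0 < a < 1 ->
  exists x, conv_defined a x /\ M < norm2 (u_plus a x).
Proof.
move=> a01; have /andP[a0 a1] := a01.
have [b [C [b0 uC]]] := u_plus_cell_growth _ a01.
(* This threshold gives [b N^(1-a) - C >= M + 1]. *)
have [|N0 N0P] := powR_nat_unbounded (1 - a) ((M + 1 + C) / b); first lra.
pose N := maxn N0 8; have xN := cell_nonempty N.
exists (dyad N, dyad N); split.
  by apply: conv_defined_cell xN; [exact: ltW|rewrite leq_max orbT].
have := uC _ _ (leq_maxr N0 8) xN.
have := N0P _ (leq_maxl N0 8); rewrite ler_pdivrMr// (mulrC _ b).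
have := norm2_ge_fst (u_plus a (dyad N, dyad N)).
by have := ler_norm (u_plus a (dyad N, dyad N)).1; rewrite -/N; lra.
Qed.

(** * Failure of local integrability *)

Lemma harmonic_tail_unbounded N0 (B : R) :
  exists n, B < \sum_(N0 <= k < n) k%:R^-1.
Proof.
apply: contrapT => /forallNP h; apply: (@dvg_harmonic R).
have {}h n : \sum_(N0 <= k < n) k%:R^-1 <= B.
  by rewrite leNgt; apply/negP; exact: h.
apply: nondecreasing_is_cvgn.
  apply/nondecreasing_seqP => n; rewrite /series /= big_nat_recr//= lerDl.
  exact: harmonic_ge0.
(* The term [harmonic k] is [1/(k+1)]. Splitting off the indices up to [N0] leaves [k > 0], where it
   is at most [1/k]. *)
exists (\sum_(0 <= k < N0.+1) harmonic k + B) => _ [n _ <-]; rewrite /series/=.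
have [nN|Nn] := leqP n N0.+1.
  have B0 : 0 <= B by have := h N0; rewrite big_geq.
  apply: ler_wpDr => //; rewrite (big_cat_nat (leq0n n) nN)/= lerDl sumr_ge0//.
rewrite (big_cat_nat (leq0n N0.+1) (ltnW Nn))/= lerD2l.
apply: le_trans (h n).
rewrite [leRHS](big_cat_nat (leqnSn N0) (ltnW Nn))/=.
rewrite ler_wpDl// ?sumr_ge0// big_nat_cond [leRHS]big_nat_cond.
apply: ler_sum => k; rewrite andbT => /andP[kN _].
have k0 : 0 < k%:R :> R by rewrite ltr0n (leq_ltn_trans _ kN).
by rewrite lef_pV2 ?posrE// -natr1; lra.
Qed.

(** The product of the lower bounds is of order [k^(1-3a) / dyad k ^+ 2], and [a <= 2/3] gives
    [k^(1-3a) >= 1/k]. *)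
Lemma u_plus_omega2_cell_ge (a : R) : 0 < a < 1 -> a <= 2 / 3 ->
  exists (c : R) N0, [/\ 0 < c, (3 <= N0)%N & forall k y, (N0 <= k)%N -> cell k y ->
    c / (dyad k ^+ 2 * k%:R) <= norm2 (u_plus a y) * omega_plus a y ^+ 2].
Proof.
move=> a01 a23; have /andP[a0 a1] := a01.
have [b [C [b0 uC]]] := u_plus_cell_growth _ a01.
(* Beyond this threshold [C] is at most half of [b k^(1-a)]. *)
have [|N0 N0P] := powR_nat_unbounded (1 - a) (2 * C / b); first lra.
pose e := b / 2; have e0 : 0 < e by exact: divr_gt0.
exists (e / 16), (maxn N0 8); split; [exact: divr_gt0|by rewrite leq_max orbT|].
move=> k y; rewrite geq_max => /andP[N0k k8] ky.
have k1 : 8 <= k%:R :> R by rewrite ler_nat.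
have k0 : 0 < k%:R :> R by lra.
set P := k%:R `^ a; set Q := k%:R `^ (1 - a); set d := dyad k.
have d0 : 0 < d := dyad_gt0 k.
have P0 : 0 < P by exact: powR_gt0.
have Q0 : 0 < Q by exact: powR_gt0.
have QP : Q * P = k%:R.
  rewrite /Q /P -powRD; last by apply/implyP => _; rewrite gt_eqF.
  by rewrite subrK powRr1// ltW.
(* The critical exponent enters here: [3a <= 2]. *)
have P3 : P ^+ 3 <= k%:R ^+ 2.
  have -> : P ^+ 3 = k%:R `^ (a * 3%:R) by rewrite powRrM powR_mulrn// ltW.
  have -> : k%:R ^+ 2 = k%:R `^ 2%:R :> R by rewrite powR_mulrn// ltW.
  by apply: ler_powR; lra.
have u1 : Q * e <= norm2 (u_plus a y).
  have := uC _ _ k8 ky; rewrite -/Q.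
  have := norm2_ge_fst (u_plus a y); have := ler_norm (u_plus a y).1.
  by have := N0P _ N0k; rewrite ler_pdivrMr// -/Q /e; lra.
have om : (4 * d * P)^-1 ^+ 2 <= omega_plus a y ^+ 2.
  have kk : (3 <= k)%N by apply: leq_trans k8.
  have h := omega_plus_cell_ge _ _ _ a01 kk ky.
  rewrite lerXn2r ?nnegrE ?omega_plus_ge0// invr_ge0 !mulr_ge0//; exact: ltW.
apply: le_trans (_ : _ <= Q * e * (4 * d * P)^-1 ^+ 2) _; last first.
  by apply: ler_pM => //; [rewrite mulr_ge0// ltW|exact: sqr_ge0].
have -> : Q * e * (4 * d * P)^-1 ^+ 2 =
    e / 16 / (d ^+ 2 * k%:R) * (k%:R ^+ 2 / P ^+ 3).
  by rewrite -QP; field; rewrite !gt_eqF.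
rewrite ler_peMr//; last by rewrite ler_pdivlMr ?exprn_gt0// mul1r.
by apply: divr_ge0; [rewrite divr_ge0// ltW|rewrite mulr_ge0 ?sqr_ge0].
Qed.

(** The area [dyad k ^+ 2 / 4] of [cell k] cancels the blow-up, so each cell contributes at least
    [c / (4k)] to the integral over the unit square. *)
Lemma u_plus_omega2_not_locally_integrable (a : R) : 0 < a < 1 -> a <= 2 / 3 ->
  ~ locally_integrable2 (fun x => norm2 (u_plus a x) * omega_plus a x ^+ 2).
Proof.
move=> a01 a23; pose g x := norm2 (u_plus a x) * omega_plus a x ^+ 2.
rewrite -/g => -[mg gK].
pose K : set (R * R) := `[0, 1]%classic `*` `[0, 1]%classic.
have {}gK : (\int[@leb2 R]_(x in K) `|g x|%:E < +oo)%E.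
  by apply: gK; apply: compact_setX; exact: segment_compact.
have [c [N0 [c0 N03 N0P]]] := u_plus_omega2_cell_ge _ a01 a23.
pose v k : R := c / (dyad k ^+ 2 * k%:R).
have mK : measurable K by apply: measurableX; exact: measurable_itv.
have low n : ((\sum_(N0 <= k < n) v k * dyad k.+1 ^+ 2)%:E <=
    \int[@leb2 R]_(x in K) `|g x|%:E)%E.
  apply: integral_ge_cells => //.
  - apply: measurableT_comp => //.
    by apply: measurable_funS mg.
  - by move=> k; apply: divr_ge0; [exact: ltW|rewrite mulr_ge0 ?sqr_ge0].
  - move=> k kn y /cell_bounds[]; have := dyad_gt0 k.+1.
    have := dyad_mono _ _ (leq0n k); rewrite {2}/dyad expr0 => *.
    by split; rewrite /= in_itv/=; apply/andP; split; lra.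
  - move=> k y /andP[kN _] ky; apply: le_trans (ler_norm _); exact: N0P.
have [I IE] : exists I : R, (\int[@leb2 R]_(x in K) `|g x|%:E = I%:E)%E.
  by eexists; rewrite -[LHS]fineK// ge0_fin_numE// integral_ge0.
(* A tail above [4 I / c] forces the cell contributions above the integral [I]. *)
have [n] := harmonic_tail_unbounded N0 (4 / c * I).
have := low n; rewrite IE lee_fin => /[swap].
suff -> : \sum_(N0 <= k < n) v k * dyad k.+1 ^+ 2 =
    c / 4 * \sum_(N0 <= k < n) k%:R^-1.
  have -> : 4 / c * I = I / (c / 4) by field; rewrite gt_eqF.
  by rewrite ltr_pdivrMr ?divr_gt0// mulrC ltNge => /negP + cI; apply.
rewrite mulr_sumr big_nat_cond [RHS]big_nat_cond.
apply: eq_bigr => k; rewrite andbT => /andP[kN _].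
have k0 : 0 < k%:R :> R by rewrite ltr0n (leq_trans _ kN)// (leq_trans _ N03).
have d0 := dyad_gt0 k.
by rewrite /v dyadS; field; rewrite !gt_eqF.
Qed.

End dyadic.

Theorem theorem5p3 (R : realType) (a : R) :
  2^-1 < a < 1 ->
  (* u^alpha_+ is unbounded *)
  (forall M : R, exists x : R * R, conv_defined a x /\ M < norm2 (u_plus a x)) /\
  (* for alpha <= 2/3, u^alpha_+ |omega^alpha_+|^2 is not locally integrable *)
  (a <= 2 / 3 ->
   ~ locally_integrable2 (fun x => norm2 (u_plus a x) * (omega_plus a x) ^+ 2)).
Proof.
move=> /andP[a2 a1].
have a01 : 0 < a < 1 by apply/andP; split; lra.
split=> [M|]; first exact: u_plus_unbounded.
exact: u_plus_omega2_not_locally_integrable.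
Qed.
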